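(* Let $S$ be a finite nonempty set of states, $C=\{0,1,\dots,K\}$ ($K\ge 1$) a finite set of consequences, and let $\succsim$ be a binary relation on the set of all lotteries on $S\times C$. If $\succsim$ satisfies axioms A1--A6, then it is represented by a nonempty closed convex set $\mathcal{V}^{**}\subseteq\mathcal{V}^{++}$ of state-dependent expected utility functions, i.e. $$\mathbf{X}\succsim\mathbf{Y}\iff U_v(\mathbf{X})-U_v(\mathbf{Y})\ge 0\ \text{ for all } v\in\mathcal{V}^{**}$$ for all lotteries $\mathbf{X},\mathbf{Y}$, such that for every constant lottery $\mathbf{X}$ the maximum and the minimum of $U_v(\mathbf{X})$ over $v\in\mathcal{V}^{**}$ are achieved at probability/utility pairs belonging to $\mathcal{V}^{**}$. In particular, if $\{\mathbf{X}_n\succsim\mathbf{Y}_n\}$ is a basis for $\succsim$ under A1--A6, then $\mathcal{V}^{**}$ contains every probability/utility pair $v\in\mathcal{V}^{++}$ that satisfies $U_v(\mathbf{X}_n)\ge U_v(\mathbf{Y}_n)$ for all $n$, and there is at least one such pair.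
   Context: A (horse) lottery is a function $\mathbf{X}:S\times C\to\mathbb{R}$ with $X(s,c)\ge 0$ for all $s,c$ and $\sum_{c}X(s,c)=1$ for every $s\in S$. It is constant if $X(s,c)=X(s',c)$ for all $s,s',c$. For $c\in C$, $\mathbf{H}_c$ is the lottery with $\mathbf{H}_c(s,c')=1$ if $c'=c$ and $0$ otherwise (for every $s$). Consequences $0$ and $1$ play the roles of worst and best. For $p\in[0,1]$, $\mathbf{H}_p=p\mathbf{H}_1+(1-p)\mathbf{H}_0$ (consistent with the notation $\mathbf{H}_0,\mathbf{H}_1$). $\mathbf{X}\succ\mathbf{Y}$ means $\mathbf{X}\succsim\mathbf{Y}$ and not $\mathbf{Y}\succsim\mathbf{X}$. An event is a subset $\mathbf{E}$ of $S$, identified with its indicator function on $S\times C$ ($E(s,c)=1$ if $s\in\mathbf{E}$, else $0$); products such as $\mathbf{E}\mathbf{X}$ are pointwise, and $\mathbf{1}$ is the constant function 1. $\mathbf{H}_{\mathbf{E}}=\mathbf{E}\mathbf{H}_1+(\mathbf{1}-\mathbf{E})\mathbf{H}_0$. The event $\mathbf{E}$ is not potentially null if $\mathbf{H}_{\mathbf{E}}\succsim\mathbf{H}_p$ for some $p>0$. The notation $\mathbf{E}\mathbf{X}\succsim\mathbf{E}\mathbf{Y}$ is shorthand for: $\mathbf{E}\mathbf{X}+(\mathbf{1}-\mathbf{E})\mathbf{Z}\succsim\mathbf{E}\mathbf{Y}+(\mathbf{1}-\mathbf{E})\mathbf{Z}$ for all lotteries $\mathbf{Z}$. Axioms (on a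 relation $\succsim$ on lotteries): - A1 (quasi order): $\succsim$ is transitive and reflexive. - A2 (mixture-independence): for all lotteries $\mathbf{X},\mathbf{Y},\mathbf{Z}$ and all $\alpha\in(0,1)$: $\mathbf{X}\succsim\mathbf{Y}\iff\alpha\mathbf{X}+(1-\alpha)\mathbf{Z}\succsim\alpha\mathbf{Y}+(1-\alpha)\mathbf{Z}$. - A3 (continuity): if $\{\mathbf{X}_n\}$, $\{\mathbf{Y}_n\}$ are convergent sequences of lotteries with $\mathbf{X}_n\succsim\mathbf{Y}_n$ for all $n$, then $\lim\mathbf{X}_n\succsim\lim\mathbf{Y}_n$. - A4 (best and worst): for all $c>1$, $\mathbf{H}_1\succsim\mathbf{H}_c\succsim\mathbf{H}_0$. - A5 (coherence/nontriviality): $\mathbf{H}_1\succ\mathbf{H}_0$, i.e. $\mathbf{H}_1\succsim\mathbf{H}_0$ and not $\mathbf{H}_0\succsim\mathbf{H}_1$. - A6 (state-independence): if $\mathbf{X}$ and $\mathbf{Y}$ are constant lotteries and $\mathbf{E}$ is not potentially null, then $\mathbf{E}\mathbf{X}\succsim\mathbf{E}\mathbf{Y}$ implies $\mathbf{F}\mathbf{X}\succsim\mathbf{F}\mathbf{Y}$ for every other event $\mathbf{F}$. A collection of preferences $\{\mathbf{X}_n\succsim\mathbf{Y}_n\}$ (a subset, possibly infinite, of the relation $\succsim$) is a basis for $\succsim$ under an axiom system if every preference $\mathbf{X}\succsim\mathbf{Y}$ can be deduced from $\{\mathbf{X}_n\succsim\mathbf{Y}_n\}$ by direct application of those axioms;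 that is, $\succsim$ is the smallest relation containing the collection and satisfying the axioms. A state-dependent expected utility (s.d.e.u.) function is a function $v:S\times C\to\mathbb{R}$; it induces $U_v(\mathbf{X})=\sum_{s\in S,c\in C}X(s,c)v(s,c)$. It is a probability/utility pair if $v(s,c)=p(s)u(c)$ for all $s,c$, for some probability distribution $p:S\to[0,1]$ and some function $u:C\to\mathbb{R}$. The normalized set is $$\mathcal{V}^{++}=\Big\{v:\ 0=v(s,0)\le v(s,c)\le v(s,1)\le 1\ \ \forall s\in S,\ c\ge 2;\ \ \sum_{s\in S}v(s,1)=1\Big\}.$$ *)

(* Defs.v *)
From mathcomp Require Import all_boot all_order all_algebra.
From mathcomp Require Import classical_sets functions reals topology normedtype convex.
Set Implicit Arguments.
Unset Strict Implicit.
Unset Printing Implicit Defensive.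
Import Order.TTheory GRing.Theory Num.Theory.
Import numFieldNormedType.Exports.
Local Open Scope classical_set_scope.
Local Open Scope ring_scope.

(* The consequences 0, ..., K are the elements of 'I_K.+1.  The consequence 1
   below has value 1 only when 0 < K. *)
Notation acts S K R := (S * 'I_K.+1 -> R).

Definition csq0 (K : nat) : 'I_K.+1 := ord0.
Definition csq1 (K : nat) : 'I_K.+1 := inord 1.

Definition lottery (R : realType) (S : finType) (K : nat) : set (acts S K R) :=
  [set X | (forall s c, 0 <= X (s, c)) /\ (forall s, \sum_c X (s, c) = 1)].
Arguments lottery {R S K}.

Definition constant_lottery (R : realType) (S : finType) (K : nat) :
    set (acts S K R) :=
  [set X | lottery X /\ forall s s' c, X (s, c) = X (s', c)].
Arguments constant_lottery {R S K}.

Definition sure (R : realType) (S : finType) (K : nat) (c : 'I_K.+1) :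
    acts S K R :=
  fun x => (x.2 == c)%:R.
Arguments sure {R S K} c.

Definition sureprob (R : realType) (S : finType) (K : nat) (p : R) :
    acts S K R :=
  p *: sure (csq1 K) + (1 - p) *: sure (csq0 K).
Arguments sureprob {R S K} p.

Definition evind (R : realType) (S : finType) (K : nat) (E : {set S}) :
    acts S K R :=
  fun x => (x.1 \in E)%:R.
Arguments evind {R S K} E.

(* The product and the 1 are those of the pointwise ring of functions. *)
Definition splice (R : realType) (S : finType) (K : nat) (E : {set S})
    (X Z : acts S K R) : acts S K R :=
  evind E * X + (1 - evind E) * Z.

Definition evlottery (R : realType) (S : finType) (K : nat) (E : {set S}) :
    acts S K R :=
  splice E (sure (csq1 K)) (sure (csq0 K)).
Arguments evlottery {R S K} E.

(* Relations on lotteries are relations on all functions S x C -> R that hold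
   between lotteries only, i.e. subsets of lottery `*` lottery. *)
Definition on_lotteries (R : realType) (S : finType) (K : nat)
    (pref : acts S K R -> acts S K R -> Prop) : Prop :=
  forall X Y, pref X Y -> lottery X /\ lottery Y.

Definition not_potentially_null (R : realType) (S : finType) (K : nat)
    (pref : acts S K R -> acts S K R -> Prop) (E : {set S}) : Prop :=
  exists p : R, [/\ 0 < p, p <= 1 & pref (evlottery E) (sureprob p)].

Definition cond_pref (R : realType) (S : finType) (K : nat)
    (pref : acts S K R -> acts S K R -> Prop) (E : {set S}) (X Y : acts S K R)
    : Prop :=
  forall Z, lottery Z -> pref (splice E X Z) (splice E Y Z).

Definition quasi_order (R : realType) (S : finType) (K : nat)
    (pref : acts S K R -> acts S K R -> Prop) : Prop :=
  (forall X Y Z, lottery X -> lottery Y -> lottery Z ->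
     pref X Y -> pref Y Z -> pref X Z) /\
  (forall X, lottery X -> pref X X).

Definition mixture_independence (R : realType) (S : finType) (K : nat)
    (pref : acts S K R -> acts S K R -> Prop) : Prop :=
  forall X Y Z (a : R), lottery X -> lottery Y -> lottery Z -> 0 < a -> a < 1 ->
    pref X Y <-> pref (a *: X + (1 - a) *: Z) (a *: Y + (1 - a) *: Z).

Definition pref_continuity (R : realType) (S : finType) (K : nat)
    (pref : acts S K R -> acts S K R -> Prop) : Prop :=
  forall (X Y : nat -> acts S K R) (X' Y' : acts S K R),
    (forall n, lottery (X n)) -> (forall n, lottery (Y n)) ->
    {ptws, X @ \oo --> X'} -> {ptws, Y @ \oo --> Y'} ->
    (forall n, pref (X n) (Y n)) -> pref X' Y'.

Definition best_worst (R : realType) (S : finType) (K : nat)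
    (pref : acts S K R -> acts S K R -> Prop) : Prop :=
  forall c : 'I_K.+1, (1 < c)%N ->
    pref (sure (csq1 K)) (sure c) /\
    pref (sure c) (sure (csq0 K)).

Definition nontriviality (R : realType) (S : finType) (K : nat)
    (pref : acts S K R -> acts S K R -> Prop) : Prop :=
  pref (sure (csq1 K)) (sure (csq0 K)) /\
  ~ pref (sure (csq0 K)) (sure (csq1 K)).

Definition state_independence (R : realType) (S : finType) (K : nat)
    (pref : acts S K R -> acts S K R -> Prop) : Prop :=
  forall (X Y : acts S K R) (E : {set S}),
    constant_lottery X -> constant_lottery Y -> not_potentially_null pref E ->
    cond_pref pref E X Y -> forall F : {set S}, cond_pref pref F X Y.

Record pref_axioms (R : realType) (S : finType) (K : nat)
    (pref : acts S K R -> acts S K R -> Prop) : Prop := PrefAxioms {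
  pref_A1 : quasi_order pref;
  pref_A2 : mixture_independence pref;
  pref_A3 : pref_continuity pref;
  pref_A4 : best_worst pref;
  pref_A5 : nontriviality pref;
  pref_A6 : state_independence pref }.

Definition is_basis (R : realType) (S : finType) (K : nat)
    (B pref : acts S K R -> acts S K R -> Prop) : Prop :=
  (forall X Y, B X Y -> pref X Y) /\
  (forall pref' : acts S K R -> acts S K R -> Prop,
     on_lotteries pref' -> pref_axioms pref' ->
     (forall X Y, B X Y -> pref' X Y) ->
     forall X Y, pref X Y -> pref' X Y).

Definition sdeu (R : realType) (S : finType) (K : nat) (v X : acts S K R) : R :=
  \sum_s \sum_c X (s, c) * v (s, c).

Definition prob_util_pair (R : realType) (S : finType) (K : nat) :
    set (acts S K R) :=
  [set v | exists (p : S -> R) (u : 'I_K.+1 -> R),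
     [/\ forall s, 0 <= p s <= 1, \sum_s p s = 1
       & forall s c, v (s, c) = p s * u c]].
Arguments prob_util_pair {R S K}.

(* The bounds on v (s, 1) are separate so that they also hold when K = 1. *)
Definition normalized_sdeu (R : realType) (S : finType) (K : nat) :
    set (acts S K R) :=
  [set v | [/\ forall s, v (s, csq0 K) = 0,
     forall s, 0 <= v (s, csq1 K) <= 1,
     forall s (c : 'I_K.+1), (2 <= c)%N -> 0 <= v (s, c) <= v (s, csq1 K)
   & \sum_s v (s, csq1 K) = 1]].
Arguments normalized_sdeu {R S K}.

Definition represents (R : realType) (S : finType) (K : nat)
    (V : set (acts S K R)) (pref : acts S K R -> acts S K R -> Prop) : Prop :=
  forall X Y, lottery X -> lottery Y ->
    (pref X Y <-> forall v, V v -> 0 <= sdeu v X - sdeu v Y).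

(* Main.v *)
Require Import Defs.
From mathcomp Require Import all_boot all_order all_algebra.
From mathcomp Require Import ring lra.
From mathcomp Require Import boolp classical_sets functions reals.
From mathcomp Require Import interval_inference topology normedtype convex.
From mathcomp Require Import derive.
Set Implicit Arguments.
Unset Strict Implicit.
Unset Printing Implicit Defensive.
Import Order.TTheory GRing.Theory Num.Theory.
Import numFieldNormedType.Exports.
Local Open Scope classical_set_scope.
Local Open Scope ring_scope.

(* Only differences of lotteries matter, so the preference is the order of a
   closed convex cone, and separation represents it by the normalized functions
   of the dual cone, V.  Every consequence-wise preference holds in each state,
   which bounds v (s, c) between v (s, 0) and v (s, 1); for the same reason each
   conditional utility v (s, .) / v (s, 1) belongs to the compact convex set
   U = {\sum_s v (s, .) : v in V} of marginal utilities.  Hence the marginal of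
   v is a convex combination, with weights v (s, 1), of points of U.  A linear
   functional on U has an extreme maximizer, namely the one of largest Euclidean
   norm; over an extreme point all conditional utilities agree, so v is a
   probability/utility pair.  Finally, the order induced by a pair satisfies the
   axioms, so it contains the relation generated by any basis it agrees with. *)

(** * Topology of real functions on a finite type *)

Definition dotf (R : realType) (T : finType) (f g : T -> R) : R :=
  \sum_t f t * g t.
Arguments dotf {R T}.

Lemma ptws_eval_continuous (R : realType) (T : finType) (t : T) :
  continuous (fun f : {ptws T -> R} => f t : R).
Proof. exact: (@proj_continuous T (fun _ => R)). Qed.

Lemma sum_continuous (R : realType) (U : topologicalType) (I : finType)
    (F : I -> U -> R) :
  (forall i, continuous (F i)) -> continuous (fun x => \sum_i F i x).
Proof.
move=> cF x; apply: cvg_big; first exact: add_continuous.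
by move=> i _; exact: cF.
Qed.

Lemma dotf_continuous (R : realType) (T : finType) (f : T -> R) :
  continuous (fun g : {ptws T -> R} => dotf f g).
Proof.
apply: (@sum_continuous R {ptws T -> R} T (fun t g => f t * g t)) => t x.
have h := @ptws_eval_continuous R T t x.
exact: (cvgM (cvg_cst (f t)) h).
Qed.

Lemma sqdist_continuous (R : realType) (T : finType) (q : T -> R) :
  continuous (fun g : {ptws T -> R} => \sum_t (g t - q t) ^+ 2).
Proof.
apply: (@sum_continuous R {ptws T -> R} T (fun t g => (g t - q t) ^+ 2)) => t x.
have h : ((g t - q t) : R) @[g --> x] --> x t - q t.
  exact: (cvgB (@ptws_eval_continuous R T t x) (cvg_cst (q t))).
exact: (cvgM h h).
Qed.

Lemma compact_min (R : realType) (U : topologicalType) (f : U -> R) (A : set U) :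
  A !=set0 -> compact A -> continuous f -> exists2 c, A c & forall t, A t -> f c <= f t.
Proof.
move=> A0 cA cf.
have [|c /set_mem Ac mc] := @compact_EVT_min U R f A A0 cA.
  exact: continuous_subspaceT.
by exists c => // t At; apply: mc; exact: mem_set.
Qed.

Lemma box_compact (R : realType) (T : finType) (M : R) :
  compact [set f : {ptws T -> R} | forall t, `|f t| <= M].
Proof.
rewrite (_ : mkset _ = [set f | forall t, `[- M, M]%classic (f t)]).
  exact: (@tychonoff T (fun _ => R) (fun _ => `[- M, M]%classic)
            (fun _ => @segment_compact R _ _)).
by apply/seteqP; split => f bf t; have := bf t; rewrite /= in_itv /= ler_norml.
Qed.

Lemma ptws_cvgP (R : realType) (T : finType) (X : nat -> T -> R) (X' : T -> R) :
  {ptws, X @ \oo --> X'} <-> forall t, X n t @[n --> \oo] --> X' t.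
Proof. exact: (@pointwise_cvgP (discrete_topology T)). Qed.

Lemma ptws_continuous (R : realType) (U : topologicalType) (T : finType)
    (F : U -> T -> R) :
  (forall t, continuous (fun x => F x t)) -> continuous (F : U -> {ptws T -> R}).
Proof.
move=> cF x; have h t : F y t @[y --> x] --> F x t by exact: cF.
exact: (@pointwise_cvgP (discrete_topology T) R (F y @[y --> x]) (F x) _).2 h.
Qed.

(** Bridges A3, which speaks of sequences, and the topological closedness that compactness needs. As
    [T] is finite, the functions within [1 / (n + 1)] of [f] in every coordinate form a
    neighbourhood of [f], so a point of the closure is the limit of a sequence in [A]. *)
Lemma seq_closed_closed (R : realType) (T : finType) (A : set {ptws T -> R}) :
  (forall (X : nat -> T -> R) (X' : T -> R), (forall n, A (X n)) ->
     (forall t, X n t @[n --> \oo] --> X' t) -> A X') ->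
  closed A.
Proof.
move=> cA f clf.
have ball_n n : exists g : {ptws T -> R}, A g /\ forall t, `|f t - g t| < n.+1%:R^-1.
  have : nbhs f [set g : {ptws T -> R} | forall t, `|f t - g t| < n.+1%:R^-1].
    apply: (@filter_forall _ T (fun t g => `|f t - g t| < n.+1%:R^-1) (nbhs f)) => t.
    have /cvgrPdist_lt/(_ n.+1%:R^-1) := @ptws_eval_continuous R T t f.
    by rewrite invr_gt0 ltr0n => /(_ isT).
  by move=> /clf [g [Ag gf]]; exists g.
have [X XP] := choice ball_n.
apply: (cA X) => [n|t]; first by have [] := XP n.
apply/cvgrPdist_lt => e e0; near=> n.
apply: lt_trans ((XP n).2 t) _; near: n.
exact: (near_infty_natSinv_lt (PosNum e0)).
Unshelve. all: by end_near. Qed.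

Lemma closure_ge (R : realType) (U : topologicalType) (A : set U) (g : U -> R) c v :
  continuous g -> (forall u, A u -> c <= g u) -> closure A v -> c <= g v.
Proof.
move=> cg gA clv; rewrite leNgt; apply/negP => gvc.
have : nbhs v (g @^-1` [set x | x < c]) by apply: cg; exact: lt_nbhsl.
by move=> /clv [u [/gA + /=]]; rewrite leNgt => /negbTE ->.
Qed.

Lemma closure_eq (R : realType) (U : topologicalType) (A : set U) (g : U -> R) c v :
  continuous g -> (forall u, A u -> g u = c) -> closure A v -> g v = c.
Proof.
move=> cg gA clv; apply/eqP; rewrite eq_le; apply/andP; split.
  rewrite -lerN2; apply: (closure_ge (A := A) (g := fun x => - g x)) => //.
    by move=> x; apply: cvgN; exact: cg.
  by move=> u /gA ->.
by apply: (closure_ge (A := A) (g := g)) => // u /gA ->.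
Qed.

(** * Convex sets: projection and extreme maximizers *)

Lemma mix_fctE (R : realType) (T : Type) (f g : T -> R) (a b : R) x :
  (a *: f + b *: g) x = a * f x + b * g x.
Proof. by []. Qed.

Lemma convex_setP (R : realType) (E : lmodType R) (A : set E) :
  convex_set (A : set (convex_lmodType E)) <->
  forall a b (t : R), A a -> A b -> 0 <= t -> t <= 1 -> A (t *: a + (1 - t) *: b).
Proof.
split=> [cA a b t Aa Ab t0 t1|cA a b t].
  have t01 : Itv.spec (@Itv.num_sem R) (Itv.Real `[0%Z, 1%Z]) t.
    by rewrite /= /Itv.num_sem /= num_real in_itv /= t0 t1.
  have := cA a b (Itv.mk t01); rewrite !inE => h; exact: h.
rewrite !inE => Aa Ab; apply: cA => //.
Qed.

Lemma convex_projection (R : realType) (T : finType) (A : set (T -> R)) (q : T -> R) :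
  A !=set0 -> compact (A : set {ptws T -> R}) ->
  convex_set (A : set (convex_lmodType (T -> R))) ->
  exists2 a, A a & forall b, A b -> 0 <= \sum_t (a t - q t) * (b t - a t).
Proof.
move=> A0 cA /convex_setP vA.
have [a Aa amin] := @compact_min R {ptws T -> R} _ A A0 cA (@sqdist_continuous R T q).
exists a => // b Ab; set P := \sum_t _.
pose D := \sum_t (b t - a t) ^+ 2.
have D0 : 0 <= D by apply: sumr_ge0 => t _; exact: sqr_ge0.
(* The right-hand side is the change of the squared distance to [q] when [a] moves to
   [a + t (b - a)]. *)
have key t : 0 <= t -> t <= 1 -> 0 <= t * (2 * P + t * D).
  move=> t0 t1; have := amin _ (vA b a t Ab Aa t0 t1); rewrite -subr_ge0.
  congr (0 <= _); rewrite /P /D !mulr_sumr -big_split /= mulr_sumr -sumrB.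
  apply: eq_bigr => x _; rewrite mix_fctE; ring.
rewrite leNgt; apply/negP => P0.
have DP : 0 < D - P by lra.
have := key (- P / (D - P)); rewrite ler_pdivlMr // mul0r ler_pdivrMr // mul1r.
move=> /(_ ltac:(lra) ltac:(lra)); rewrite leNgt => /negP; apply.
rewrite pmulr_rlt0 ?divr_gt0 ?oppr_gt0 //.
have : - P / (D - P) * D <= - P; last lra.
by rewrite mulrAC ler_pdivrMr //; nra.
Qed.

(** Take [a] of largest norm on the face [B] of maximizers of [f]. In a convex combination equal to
    [a], every point of positive weight is in [B], and strict convexity of the norm forces it to be
    [a]. Points of weight 0 are left free because conditional utilities at null states are quotients
    by 0. *)
Lemma compact_extreme_max (R : realType) (T : finType) (A : set (T -> R)) (f : T -> R) :
  A !=set0 -> compact (A : set {ptws T -> R}) ->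
  exists a, [/\ A a, forall b, A b -> dotf f b <= dotf f a &
    forall (I : finType) (p : I -> R) (b : I -> T -> R),
      (forall i, 0 <= p i) -> \sum_i p i = 1 -> (forall i, 0 < p i -> A (b i)) ->
      (forall t, a t = \sum_i p i * b i t) -> forall i, 0 < p i -> b i = a].
Proof.
move=> A0 cA.
have cf := @dotf_continuous R T f.
have [m Am mmax] := @compact_min R {ptws T -> R} (fun g => - dotf f g) A A0 cA
  (fun x => cvgN (cf x)).
pose B : set {ptws T -> R} := A `&` [set g : {ptws T -> R} | dotf f m <= dotf f g].
have clB : closed [set g : {ptws T -> R} | dotf f m <= dotf f g].
  by move=> g clg; apply: (closure_ge cf _ clg).
have cB : compact (B : set {ptws T -> R}) by exact: compact_closedI.
have nB : continuous (fun g : {ptws T -> R} => - \sum_t (g t - 0) ^+ 2).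
  by move=> x; exact: (cvgN (@sqdist_continuous R T (fun=> 0) x)).
have [|a [Aa /= ma] amax] := @compact_min R {ptws T -> R} _ B _ cB nB; first by exists m; split => //=.
have am b : A b -> dotf f b <= dotf f a.
  by move=> Ab; apply: le_trans ma; rewrite -lerN2; exact: mmax.
exists a; split => // I p b p0 p1 Ab aE.
have dotfE : dotf f a = \sum_i p i * dotf f (b i).
  rewrite /dotf; under eq_bigr do rewrite aE mulr_sumr.
  rewrite exchange_big /=; apply: eq_bigr => i _; rewrite mulr_sumr.
  by apply: eq_bigr => t _; rewrite mulrCA.
have ge0 i : 0 <= p i * (dotf f a - dotf f (b i)).
  have [p_gt0|] := ltP 0 (p i); first by rewrite mulr_ge0 // subr_ge0 am //; exact: Ab.
  by move=> pi; have -> : p i = 0; [apply/le_anti; rewrite pi p0|rewrite mul0r].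
have fb i : 0 < p i -> dotf f (b i) = dotf f a.
  move=> pi; have : \sum_i p i * (dotf f a - dotf f (b i)) = 0.
    under eq_bigr do rewrite mulrBr.
    by rewrite sumrB -mulr_suml p1 mul1r -dotfE subrr.
  move=> /(psumr_eq0P (fun i _ => ge0 i))/(_ i isT)/eqP.
  by rewrite mulf_eq0 gt_eqF //= subr_eq0 => /eqP.
have nb i : 0 < p i -> \sum_t (b i t) ^+ 2 <= \sum_t (a t) ^+ 2.
  move=> pi; have := amax (b i) (conj (Ab i pi) _).
  rewrite lerN2 /= fb // => /(_ ma).
  by under eq_bigr do rewrite subr0; under [leRHS]eq_bigr do rewrite subr0.
(* Variance identity: the mean of the [b i] is [a], so their mean squared distance to [a] is the
   mean of the squared norms minus that of [a]. *)
have dist0 : \sum_i p i * \sum_t (b i t - a t) ^+ 2 <= 0.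
  have -> : \sum_i p i * \sum_t (b i t - a t) ^+ 2 =
      \sum_i p i * (\sum_t (b i t) ^+ 2 - \sum_t (a t) ^+ 2).
    apply/eqP; rewrite -subr_eq0 -sumrB; apply/eqP.
    transitivity (\sum_i p i * \sum_t (2 * (a t - b i t) * a t)).
      apply: eq_bigr => i _; rewrite -mulrBr -!sumrB; congr (_ * _).
      by apply: eq_bigr => t _; ring.
    under eq_bigr do rewrite mulr_sumr.
    rewrite exchange_big big1 // => t _.
    transitivity (2 * a t * (\sum_i p i * a t - \sum_i p i * b i t)).
      by rewrite -sumrB mulr_sumr; apply: eq_bigr => i _; ring.
    by rewrite -aE -mulr_suml p1 mul1r subrr mulr0.
  apply: sumr_le0 => i _; have [pi|] := ltP 0 (p i).
    by rewrite pmulr_rle0 // subr_le0 nb.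
  by move=> pi; have -> : p i = 0; [apply/le_anti; rewrite pi p0|rewrite mul0r].
move=> i pi; apply/funext => t.
have sq0 j : 0 <= \sum_t (b j t - a t) ^+ 2 by apply: sumr_ge0 => *; exact: sqr_ge0.
have /psumr_eq0P/(_ i isT)/eqP : \sum_i p i * \sum_t (b i t - a t) ^+ 2 = 0.
  by apply/le_anti; rewrite dist0 sumr_ge0 // => j _; rewrite mulr_ge0.
rewrite mulf_eq0 gt_eqF //= => h.
have /psumr_eq0P/(_ t isT)/eqP : \sum_t (b i t - a t) ^+ 2 = 0.
  by apply/eqP; apply: h => j _; rewrite mulr_ge0.
rewrite sqrf_eq0 subr_eq0 => h'; apply/eqP; apply: h' => *; exact: sqr_ge0.
Qed.

(** * Expected utility as a bilinear pairing; lotteries and splices *)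

Lemma sdeuE (R : realType) (S : finType) (K : nat) (v X : acts S K R) :
  sdeu v X = dotf X v.
Proof.
by rewrite /sdeu /dotf pair_bigA; apply: eq_bigr => -[].
Qed.

Lemma dotfC (R : realType) (T : finType) (f g : T -> R) : dotf f g = dotf g f.
Proof. by apply: eq_bigr => t _; rewrite mulrC. Qed.

Lemma dotf_mixr (R : realType) (T : finType) (f g h : T -> R) (a b : R) :
  dotf f (a *: g + b *: h) = a * dotf f g + b * dotf f h.
Proof.
rewrite /dotf !mulr_sumr -big_split; apply: eq_bigr => t _.
by rewrite mix_fctE /=; ring.
Qed.

Lemma dotf_mixl (R : realType) (T : finType) (f g h : T -> R) (a b : R) :
  dotf (a *: g + b *: h) f = a * dotf g f + b * dotf h f.
Proof. by rewrite !(dotfC _ f) dotf_mixr. Qed.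

Section Lotteries.
Context (R : realType) (S : finType) (K : nat).
Implicit Types (X Y Z v : acts S K R) (E F : {set S}).

Lemma lottery_ge0 X x : lottery X -> 0 <= X x.
Proof. by case: x => s c [X0 _]. Qed.

Lemma lottery_sum1 X s : lottery X -> \sum_c X (s, c) = 1.
Proof. by case. Qed.

Lemma lottery_le1 X x : lottery X -> X x <= 1.
Proof.
case: x => s c lX; rewrite -(lottery_sum1 s lX) (bigD1 c) //= lerDl.
by apply: sumr_ge0 => *; exact: lottery_ge0.
Qed.

Lemma lottery_mix X Y (t : R) : lottery X -> lottery Y -> 0 <= t -> t <= 1 ->
  lottery (t *: X + (1 - t) *: Y).
Proof.
move=> lX lY t0 t1; split => [s c|s].
  by rewrite mix_fctE addr_ge0 // mulr_ge0 ?subr_ge0 // lottery_ge0.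
under eq_bigr do rewrite mix_fctE.
by rewrite big_split -!mulr_sumr !lottery_sum1 //=; ring.
Qed.

Lemma lottery_sure c : lottery (sure c : acts S K R).
Proof.
split=> [s c'|s]; first by rewrite /sure ler0n.
by rewrite /sure (bigD1 c) //= eqxx big1 ?addr0 // => c' /negPf ->.
Qed.

Lemma constant_lottery_sure c : constant_lottery (sure c : acts S K R).
Proof. by split; first exact: lottery_sure. Qed.

Lemma spliceE E X Z x : splice E X Z x = if x.1 \in E then X x else Z x.
Proof.
rewrite /splice /evind.
change ((x.1 \in E)%:R * X x + (1 - (x.1 \in E)%:R) * Z x = (if x.1 \in E then X x else Z x)).
by case: ifP => _; rewrite ?subrr ?subr0 !(mul1r, mul0r) ?addr0 ?add0r.
Qed.

Lemma splice_setT X Z : splice [set: S]%SET X Z = X.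
Proof. by apply/funext => x; rewrite spliceE inE. Qed.

Lemma lottery_splice E X Z : lottery X -> lottery Z -> lottery (splice E X Z).
Proof.
move=> lX lZ; split=> [s c|s]; first by rewrite spliceE; case: ifP => _; exact: lottery_ge0.
rewrite (eq_bigr (fun c => if s \in E then X (s, c) else Z (s, c))) => [|c _].
  by case: (s \in E); exact: lottery_sum1.
by rewrite spliceE.
Qed.

Lemma sdeu_splice v E X Z : sdeu v (splice E X Z) =
  \sum_(s in E) \sum_c X (s, c) * v (s, c) +
  \sum_(s | s \notin E) \sum_c Z (s, c) * v (s, c).
Proof.
rewrite /sdeu (bigID (mem E)) /=; congr (_ + _); apply: eq_bigr => s sE;
  apply: eq_bigr => c _; by rewrite spliceE /= ?sE ?(negPf sE).
Qed.

(** Base point for directions: all its entries are positive, so small perturbations with zero sum in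
    each state are still lotteries. *)
Definition uniform_lottery : acts S K R := fun=> K.+1%:R^-1.

Lemma constant_lottery_uniform : constant_lottery uniform_lottery.
Proof.
split=> //; split=> [s c|s]; first by rewrite invr_ge0 ler0n.
by rewrite /uniform_lottery sumr_const card_ord -[LHS]mulr_natr mulVf.
Qed.

Lemma lottery_uniform : lottery uniform_lottery.
Proof. exact: constant_lottery_uniform.1. Qed.

Lemma lottery_uniformD (W : acts S K R) :
  (forall x, `|W x| <= K.+1%:R^-1) -> (forall s, \sum_c W (s, c) = 0) ->
  lottery (uniform_lottery + W).
Proof.
move=> W1 W0; split=> [s c|s].
  change (0 <= K.+1%:R^-1 + W (s, c)).
  by have := W1 (s, c); rewrite ler_norml -lerBlDl sub0r => /andP[].
transitivity (\sum_c (uniform_lottery (s, c) + W (s, c))); first by [].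
by rewrite big_split /= (lottery_sum1 s lottery_uniform) W0 addr0.
Qed.

Definition dual_cone (pref : acts S K R -> acts S K R -> Prop) : set (acts S K R) :=
  [set v | forall X Y, pref X Y -> sdeu v Y <= sdeu v X].

End Lotteries.
Arguments dual_cone {R S K} pref.
Arguments uniform_lottery {R S K}.

(** * Separation from the cone of preferred directions *)

Section Separation.
Context (R : realType) (S : finType) (K : nat).
Hypothesis K_ge1 : (1 <= K)%N.
Context (pref : acts S K R -> acts S K R -> Prop).
Hypotheses (pref_lot : on_lotteries pref) (pref_ax : pref_axioms pref).
Implicit Types X Y Z : acts S K R.

Local Notation u := (@uniform_lottery R S K).
Local Notation n := (K.+1%:R : R).

Let n_gt1 : 1 < n. Proof. by rewrite ltr1n ltnS. Qed.
Let nV_gt0 : 0 < n^-1. Proof. by rewrite invr_gt0. Qed.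
Let nV_lt1 : n^-1 < 1. Proof. by rewrite invf_lt1. Qed.

(** The components are replaced one at a time, through [t *: Y + (1 - t) *: X']. A2 covers only
    [0 < t < 1], hence the two end cases. *)
Lemma pref_mix X X' Y Y' (t : R) : pref X Y -> pref X' Y' -> 0 <= t -> t <= 1 ->
  pref (t *: X + (1 - t) *: X') (t *: Y + (1 - t) *: Y').
Proof.
move=> XY XY'; have [lX lY] := pref_lot XY; have [lX' lY'] := pref_lot XY'.
rewrite le_eqVlt => /predU1P[<- _|t0].
  by rewrite !scale0r !add0r subr0 !scale1r.
rewrite le_eqVlt => /predU1P[->|t1].
  by rewrite subrr !scale0r !addr0 !scale1r.
have [ptrans _] := pref_A1 pref_ax.
have lm A B : lottery A -> lottery B -> lottery (t *: A + (1 - t) *: B).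
  by move=> lA lB; apply: lottery_mix => //; exact: ltW.
apply: (ptrans _ (t *: Y + (1 - t) *: X')); try exact: lm.
  exact/(pref_A2 pref_ax lX lY lX').
have t1' : 0 < 1 - t by rewrite subr_gt0.
have t1'' : 1 - t < 1 by lra.
have /(pref_A2 pref_ax lX' lY' lY t1' t1'') := XY'.
by rewrite (_ : 1 - (1 - t) = t); [rewrite ![_ + t *: Y]addrC|ring].
Qed.

(* Mixing both sides with the right lottery turns the lower one into the
   uniform lottery, so a preference depends only on the difference. *)
Lemma pref_uniform X Y : lottery X -> lottery Y ->
  pref X Y <-> pref (u + n^-1 *: (X - Y)) u.
Proof.
move=> lX lY.
(* [Z] solves [n^-1 *: Y + (1 - n^-1) *: Z = u]; it is nonnegative because the entries of [Y] are at
   most 1. *)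
pose Z := (1 - n^-1)^-1 *: (u - n^-1 *: Y).
have n1 : 0 < 1 - n^-1 by rewrite subr_gt0.
have ZE x : Z x = (1 - n^-1)^-1 * (n^-1 * (1 - Y x)).
  transitivity ((1 - n^-1)^-1 * (n^-1 - n^-1 * Y x)); first by [].
  by rewrite [n^-1 * (1 - _)]mulrBr mulr1.
have lZ : lottery Z.
  split=> [s c|s].
    by rewrite ZE mulr_ge0 ?invr_ge0 ?(ltW n1) // mulr_ge0 ?(ltW nV_gt0) // subr_ge0 lottery_le1.
  under eq_bigr do rewrite ZE.
  rewrite -!mulr_sumr sumrB (lottery_sum1 s lY) sumr_const card_ord.
  rewrite mulrBr mulVf ?gt_eqF // mulr1 mulVf // gt_eqF //.
have mixE W : n^-1 *: W + (1 - n^-1) *: Z = u + n^-1 *: (W - Y).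
  by rewrite /Z scalerA mulfV ?gt_eqF // scale1r addrCA scalerBr.
by rewrite (pref_A2 pref_ax lX lY lZ nV_gt0 nV_lt1) !mixE subrr scaler0 addr0.
Qed.


(** The bound 1 gives compactness and still admits every difference of lotteries. Zero sums in each
    state are implicit, as [pref] holds between lotteries only. *)
Let cone_slice : set (acts S K R) :=
  [set W | forall x, `|W x| <= 1] `&` [set W | pref (u + n^-1 *: W) u].

Let cone_slice_compact : compact (cone_slice : set {ptws S * 'I_K.+1 -> R}).
Proof.
apply: compact_closedI; first exact: box_compact.
apply: seq_closed_closed => X X' pX cX.
apply: (pref_A3 pref_ax (X := fun m => u + n^-1 *: X m) (Y := fun=> u)) => //.
- by move=> m; exact: (pref_lot (pX m)).1.
- by move=> m; exact: lottery_uniform.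
- apply/ptws_cvgP => x.
  exact: (cvgD (cvg_cst (u x)) (cvgM (cvg_cst n^-1) (cX x))).
- by apply/ptws_cvgP => x; exact: cvg_cst.
Qed.

Let cone_slice_convex : convex_set (cone_slice : set (convex_lmodType (acts S K R))).
Proof.
apply/convex_setP => W W' t [W1 pW] [W'1 pW'] t0 t1; split => [x|].
  rewrite mix_fctE; have := W1 x; have := W'1 x; rewrite !ler_norml.
  by move=> /andP[? ?] /andP[? ?]; apply/andP; split; nra.
have := pref_mix pW pW' t0 t1.
congr (pref _ _); apply/funext => x.
  change (t * (n^-1 + n^-1 * W x) + (1 - t) * (n^-1 + n^-1 * W' x) =
          n^-1 + n^-1 * (t * W x + (1 - t) * W' x)); ring.
by change (t * n^-1 + (1 - t) * n^-1 = n^-1); ring.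
Qed.

(** Mixing with [u] shrinks the direction by [t]; since A2 is an equivalence, only the ray of [W]
    matters. *)
Let cone_slice_scale W (t : R) : 0 < t -> t < 1 -> lottery (u + n^-1 *: W) ->
  pref (u + n^-1 *: W) u <-> pref (u + n^-1 *: (t *: W)) u.
Proof.
move=> t0 t1 lW; have lu := @lottery_uniform R S K.
rewrite (pref_A2 pref_ax lW lu lu t0 t1).
have -> : t *: (u + n^-1 *: W) + (1 - t) *: u = u + n^-1 *: (t *: W).
  apply/funext => x.
  change (t * (n^-1 + n^-1 * W x) + (1 - t) * n^-1 = n^-1 + n^-1 * (t * W x)); ring.
by have -> : t *: u + (1 - t) *: u = u by rewrite -scalerDl addrC subrK scale1r.
Qed.

(* Separation of X - Y from the closed convex cone of preferred directions.
   The projection is taken on the compact slice of directions bounded by 1;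
   rescaling the target to have norm at most 1/4 keeps the projection a away
   from the artificial boundary, so 2a is still in the slice. *)
Lemma dual_cone_separation X Y : lottery X -> lottery Y -> ~ pref X Y ->
  exists2 v, dual_cone pref v & sdeu v X < sdeu v Y.
Proof.
move=> lX lY nXY.
have lu := @lottery_uniform R S K.
have uu : pref u u by exact: (pref_A1 pref_ax).2.
pose N : R := #|{: S * 'I_K.+1}|%:R.
have N0 : 0 <= N by rewrite ler0n.
(* The [N] entries of [q] are bounded by [e], so its squared norm is at most
   [N * e ^+ 2 <= (4^-1) ^+ 2]. *)
pose e := (4 * (1 + N))^-1.
have e0 : 0 < e by rewrite invr_gt0; lra.
have eN : e * (4 * (1 + N)) = 1 by rewrite mulVf // gt_eqF //; lra.
have e1 : e < 1 by nra.
pose q : acts S K R := e *: (X - Y).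
have diff1 X' Y' x : lottery X' -> lottery Y' -> `|(X' - Y') x| <= 1.
  move=> lX' lY'; change (`|X' x - Y' x| <= 1); rewrite ler_norml.
  have := lottery_le1 x lX'; have := lottery_le1 x lY'.
  by have := lottery_ge0 x lX'; have := lottery_ge0 x lY'; lra.
have slice0 : cone_slice 0.
  split; last by rewrite /= scaler0 addr0.
  by move=> x; change (`|0 : R| <= 1); rewrite normr0.
have [a [a1 pa] aP] := convex_projection q (ex_intro _ _ slice0) cone_slice_compact cone_slice_convex.
pose z : acts S K R := a - q.
have zE x : z x = a x - q x by [].
have az : \sum_x z x * a x <= 0.
  have := aP _ slice0; rewrite -oppr_ge0 -sumrN.
  by congr (0 <= _); apply: eq_bigr => x _; rewrite zE; change ((0 : acts S K R) x) with (0 : R); ring.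
have qe x : `|q x| <= e.
  change (`|e * (X - Y) x| <= e); rewrite normrM gtr0_norm //.
  by have := diff1 X Y x lX lY; nra.
have q2 : \sum_x (q x) ^+ 2 <= (4^-1) ^+ 2.
  apply: (@le_trans _ _ (\sum_(x : S * 'I_K.+1) e ^+ 2)).
    apply: ler_sum => x _; rewrite -real_normK ?num_real // lerXn2r ?nnegrE //; exact: ltW.
  rewrite sumr_const -mulr_natl -/N.
  have : N * e * e <= 4^-1 * e by nra.
  nra.
(* Since [q = a - z] and [z] has nonpositive product with [a], [z] is no longer than [q]. Hence
   entries of [z] and [q] are at most 1/4, and those of [a = z + q] at most 1/2. *)
have z2 : \sum_x (z x) ^+ 2 <= \sum_x (q x) ^+ 2.
  have : \sum_x (z x) ^+ 2 + \sum_x (a x) ^+ 2 - 2 * \sum_x z x * a x = \sum_x (q x) ^+ 2.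
    rewrite mulr_sumr -big_split -sumrB; apply: eq_bigr => x _ /=; rewrite zE; ring.
  have : 0 <= \sum_x (a x) ^+ 2 by apply: sumr_ge0 => *; exact: sqr_ge0.
  by lra.
have a2 x : `|(2 *: a) x| <= 1.
  have z4 : `|z x| <= 4^-1.
    rewrite -(@ler_pXn2r _ 2) ?nnegrE //.
    rewrite real_normK ?num_real //; apply: le_trans (le_trans z2 q2).
    by rewrite (bigD1 x) //= lerDl; apply: sumr_ge0 => *; exact: sqr_ge0.
  have e4 : e <= 4^-1 by nra.
  have := qe x; move: z4; rewrite zE; change ((2 *: a) x) with (2 * a x).
  by rewrite !ler_norml => /andP[? ?] /andP[? ?]; apply/andP; split; lra.
have la2 : lottery (u + n^-1 *: (2 *: a)).
  apply: lottery_uniformD => [x|s].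
    change (`|n^-1 * (2 *: a) x| <= n^-1); rewrite normrM gtr0_norm //.
    by rewrite ler_piMr // ltW.
  have [la _] := pref_lot pa; have := lottery_sum1 s la.
  transitivity (\sum_c (2 * (u + n^-1 *: a) (s, c) - 2 * u (s, c))).
    by apply: eq_bigr => c _; change (n^-1 * (2 * a (s, c)) = 2 * (n^-1 + n^-1 * a (s, c)) - 2 * n^-1); ring.
  by rewrite sumrB -!mulr_sumr !lottery_sum1 ?subrr.
have slice2 : cone_slice (2 *: a).
  split=> //=; apply/(@cone_slice_scale _ 2^-1) => //; try lra.
  have -> //: 2^-1 *: (2 *: a) = a by rewrite scalerA mulVf ?scale1r // pnatr_eq0.
(* The projection inequality at 0 and at [2 *: a] gives both signs; [z] is then nonnegative on the
   whole slice. *)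
have az0 : \sum_x z x * a x = 0.
  apply/eqP; rewrite eq_le az /=; have := aP _ slice2.
  by congr (0 <= _); apply: eq_bigr => x _; rewrite zE; change ((2 *: a) x) with (2 * a x); ring.
have zslice W : cone_slice W -> 0 <= dotf z W.
  move=> /aP; congr (0 <= _); transitivity (dotf z W - \sum_x z x * a x); last by rewrite az0 subr0.
  by rewrite /dotf -sumrB; apply: eq_bigr => x _; rewrite zE; ring.
have sdeuB X' Y' : dotf z (X' - Y') = sdeu z X' - sdeu z Y'.
  by rewrite !sdeuE !(dotfC _ z) /dotf -sumrB; apply: eq_bigr => x _; rewrite -mulrBr.
exists z => [X' Y' p'|].
  have [lX' lY'] := pref_lot p'.
  rewrite -subr_ge0 -sdeuB; apply: zslice; split => [x|]; first exact: diff1.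
  exact/(pref_uniform lX' lY').
have zq : dotf z q = e * (sdeu z X - sdeu z Y).
  by rewrite -sdeuB /dotf mulr_sumr; apply: eq_bigr => x _; change (q x) with (e * (X - Y) x); ring.
have zqz : dotf z q = - \sum_x (z x) ^+ 2.
  transitivity (\sum_x z x * a x - \sum_x (z x) ^+ 2); last by rewrite az0 sub0r.
  by rewrite -sumrB; apply: eq_bigr => x _; rewrite zE; ring.
rewrite -subr_lt0 -(pmulr_rlt0 _ e0) -zq zqz oppr_lt0 lt_neqAle eq_sym.
rewrite sumr_ge0 ?andbT; last by move=> *; exact: sqr_ge0.
(* If [z = 0], then [q] is the preferred direction [a], and scaling back by [e] yields
   [pref X Y]. *)
apply/negP => /eqP z0.
have aq : a = q.
  apply/funext => x; apply/eqP; rewrite -subr_eq0 -zE -sqrf_eq0; apply/eqP.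
  by have /psumr_eq0P := z0; apply=> // *; exact: sqr_ge0.
apply: nXY; apply/(pref_uniform lX lY); apply/(@cone_slice_scale _ e) => //.
  apply: lottery_uniformD => [x|s].
    change (`|n^-1 * (X - Y) x| <= n^-1); rewrite normrM gtr0_norm //.
    by rewrite ler_piMr ?diff1 // ltW.
  transitivity (n^-1 * \sum_c (X (s, c) - Y (s, c))).
    by rewrite mulr_sumr.
  by rewrite sumrB !lottery_sum1 // subrr mulr0.
by rewrite -/q -aq.
Qed.

End Separation.

(** * Normalized utility functions *)

Section Normalization.
Context (R : realType) (S : finType) (K : nat).
Hypothesis K_ge1 : (1 <= K)%N.
Implicit Types (v X Y : acts S K R).

Lemma val_csq1 : csq1 K = 1%N :> nat.
Proof. by rewrite /csq1 inordK // ltnS. Qed.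

Lemma csq_cases (c : 'I_K.+1) : [\/ c = csq0 K, c = csq1 K | (1 < c)%N].
Proof.
case: c => -[|[|m]] i; [constructor 1|constructor 2|constructor 3] => //; apply/val_inj => //=.
by rewrite val_csq1.
Qed.

Lemma normalized_bounds v s c : normalized_sdeu v -> 0 <= v (s, c) <= v (s, csq1 K).
Proof.
move=> [v0 v1 vc _]; have /andP[v1_ge0 _] := v1 s.
by case: (csq_cases c) => [->|->|/vc //]; rewrite ?v0 ?v1_ge0 ?lexx.
Qed.

Lemma sdeu_sure v c : sdeu v (sure c) = \sum_s v (s, c).
Proof.
apply: eq_bigr => s _; rewrite (bigD1 c) //= {1}/sure eqxx mul1r.
by rewrite big1 ?addr0 // => c' /negPf cc'; rewrite /sure /= cc' mul0r.
Qed.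

(** Each state carries total mass 1, so shifting [v] within a state adds the same constant for all
    lotteries; for [t > 0] their ranking is unchanged. *)
Lemma sdeu_normalize v X (t : R) : lottery X ->
  sdeu (fun x => (v x - v (x.1, csq0 K)) / t) X = (sdeu v X - \sum_s v (s, csq0 K)) / t.
Proof.
move=> lX; rewrite /sdeu -sumrB mulr_suml; apply: eq_bigr => s _ /=.
rewrite -[v (s, csq0 K) in RHS]mul1r -(lottery_sum1 s lX) mulr_suml -sumrB mulr_suml.
by apply: eq_bigr => c _; ring.
Qed.

End Normalization.

(** * The representing set: separation, closedness, convexity *)

Section Representation.
Context (R : realType) (S : finType) (K : nat).
Hypothesis K_ge1 : (1 <= K)%N.
Context (pref : acts S K R -> acts S K R -> Prop).
Hypotheses (pref_lot : on_lotteries pref) (pref_ax : pref_axioms pref).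
Implicit Types (v X Y Z : acts S K R).

(** The sure event is not potentially null (take [p = 1]), and conditioning on it changes nothing,
    so A6 transfers the preference to any [F]. *)
Lemma constant_pref_cond X Y (F : {set S}) :
  constant_lottery X -> constant_lottery Y -> pref X Y -> cond_pref pref F X Y.
Proof.
move=> cX cY XY; apply: (pref_A6 pref_ax (E := [set: S]%SET)) => //.
  exists 1; split=> //; rewrite /evlottery splice_setT /sureprob.
  rewrite scale1r subrr scale0r addr0; apply: (pref_A1 pref_ax).2.
  exact: lottery_sure.
by move=> Z _; rewrite !splice_setT.
Qed.

(** Condition on [[set s]] and use [X] elsewhere: the other states cancel. *)
Lemma dual_cone_state v X Y s : dual_cone pref v ->
  constant_lottery X -> constant_lottery Y -> pref X Y ->
  \sum_c Y (s, c) * v (s, c) <= \sum_c X (s, c) * v (s, c).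
Proof.
move=> dv cX cY XY; have := dv _ _ (constant_pref_cond [set s] cX cY XY cX.1).
by rewrite !sdeu_splice !big_set1 lerD2r.
Qed.

Lemma dual_cone_bounds v s c : dual_cone pref v ->
  v (s, csq0 K) <= v (s, c) <= v (s, csq1 K).
Proof.
move=> dv.
have le_v c1 c2 : pref (sure c1) (sure c2) -> v (s, c2) <= v (s, c1).
  move/(dual_cone_state s dv (constant_lottery_sure _ _ c1) (constant_lottery_sure _ _ c2)).
  have sE c' : \sum_c0 sure c' (s, c0) * v (s, c0) = v (s, c').
    rewrite (bigD1 c') //= {1}/sure eqxx mul1r big1 ?addr0 // => c0 /negPf h.
    by rewrite /sure /= h mul0r.
  by rewrite !sE.
have [h10 _] := pref_A5 pref_ax.
by case: (csq_cases K_ge1 c) => [->|->|/(pref_A4 pref_ax)[h1 h0]]; rewrite ?lexx ?le_v.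
Qed.

Definition rep_set : set (acts S K R) := dual_cone pref `&` normalized_sdeu.

Lemma rep_set_separation X Y : lottery X -> lottery Y -> ~ pref X Y ->
  exists2 v, rep_set v & sdeu v X < sdeu v Y.
Proof.
move=> lX lY nXY.
have [z dz zXY] := dual_cone_separation K_ge1 pref_lot pref_ax lX lY nXY.
pose T := \sum_s (z (s, csq1 K) - z (s, csq0 K)).
have d_ge0 s : 0 <= z (s, csq1 K) - z (s, csq0 K).
  by rewrite subr_ge0; have /andP[] := dual_cone_bounds s (csq1 K) dz.
have T0 : 0 < T.
  (* If [T = 0], the bounds make [z] independent of the consequence, so it cannot separate two
     lotteries. *)
  rewrite lt_neqAle eq_sym sumr_ge0 ?andbT //; apply/negP => /eqP T0.
  have zc s c : z (s, c) = z (s, csq0 K).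
    have /psumr_eq0P/(_ s isT)/eqP := T0.
    move/(_ (fun s _ => d_ge0 s)); rewrite subr_eq0 => /eqP z10.
    have /andP[h0 h1] := dual_cone_bounds s c dz.
    by apply/le_anti; rewrite -{1}z10 h0 h1.
  have zcst X' : lottery X' -> sdeu z X' = \sum_s z (s, csq0 K).
    move=> lX'; apply: eq_bigr => s _; under eq_bigr do rewrite zc.
    by rewrite -mulr_suml lottery_sum1 // mul1r.
  by move: zXY; rewrite !zcst // ltxx.
exists (fun x => (z x - z (x.1, csq0 K)) / T); last first.
  by rewrite !sdeu_normalize // ltr_pM2r ?invr_gt0 // ltrD2r.
split=> [X' Y' XY'|].
  have [lX' lY'] := pref_lot XY'.
  by rewrite !sdeu_normalize // ler_pM2r ?invr_gt0 // lerD2r; exact: dz.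
split=> [s|s|s c _|] /=.
- by rewrite subrr mul0r.
- rewrite divr_ge0 ?(ltW T0) //= ler_pdivrMr // mul1r /T (bigD1 s) //= lerDl.
  by apply: sumr_ge0.
- have /andP[h0 h1] := dual_cone_bounds s c dz.
  by rewrite divr_ge0 ?subr_ge0 ?(ltW T0) //= ler_pM2r ?invr_gt0 // lerD2r.
- by rewrite -mulr_suml mulfV // gt_eqF.
Qed.

Lemma rep_set_represents : represents rep_set pref.
Proof.
move=> X Y lX lY; split=> [XY v [dv _]|h]; first by rewrite subr_ge0; exact: dv.
have [//|nXY] := pselect (pref X Y).
have [v Vv] := rep_set_separation lX lY nXY.
by rewrite ltNge -subr_ge0 h.
Qed.

Lemma rep_set_neq0 : rep_set !=set0.
Proof.
have [_ n01] := pref_A5 pref_ax.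
have [v Vv _] := rep_set_separation (lottery_sure _ _ _) (lottery_sure _ _ _) n01.
by exists v.
Qed.

Lemma rep_set_closed : closed (rep_set : set {ptws S * 'I_K.+1 -> R}).
Proof.
have cev x := @ptws_eval_continuous R (S * 'I_K.+1)%type x.
move=> v clv; split.
  move=> X Y XY; rewrite -subr_ge0.
  have -> : sdeu v X - sdeu v Y = dotf (X - Y) v.
    by rewrite !sdeuE /dotf -sumrB; apply: eq_bigr => x _; rewrite -mulrBl.
  apply: (closure_ge (@dotf_continuous R _ (X - Y)) _ clv) => w [dw _].
  have -> : dotf (X - Y) w = sdeu w X - sdeu w Y.
    by rewrite !sdeuE /dotf -sumrB; apply: eq_bigr => x _; rewrite -mulrBl.
  by rewrite subr_ge0; exact: dw.
have v0 s c : 0 <= v (s, c).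
  by apply: (closure_ge (cev (s, c)) _ clv) => w [_ /(normalized_bounds K_ge1 s c) /andP[]].
have v1 s c : v (s, c) <= v (s, csq1 K).
  rewrite -subr_ge0.
  apply: (closure_ge (g := fun w : {ptws _ -> _} => w (s, csq1 K) - w (s, c)) _ _ clv).
    by move=> w; exact: (cvgB (cev (s, csq1 K) w) (cev (s, c) w)).
  by move=> w [_ /(normalized_bounds K_ge1 s c) /andP[_ h]]; rewrite subr_ge0.
have vsum : \sum_s v (s, csq1 K) = 1.
  apply: (closure_eq (g := fun w : {ptws _ -> _} => \sum_s w (s, csq1 K)) _ _ clv).
    apply: (@sum_continuous R {ptws S * 'I_K.+1 -> R} S (fun s w => w (s, csq1 K))) => s.
    exact: cev.
  by move=> w [_ []].
split=> // [s|s|s c _].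
- by apply: (closure_eq (cev (s, csq0 K)) _ clv) => w [_ []].
- by rewrite v0 -vsum (bigD1 s) //= lerDl sumr_ge0.
- by rewrite v0 v1.
Qed.

Lemma rep_set_convex : convex_set (rep_set : set (convex_lmodType (acts S K R))).
Proof.
apply/convex_setP => v w t [dv nv] [dw nw] t0 t1.
have t1' : 0 <= 1 - t by rewrite subr_ge0.
split=> [X Y XY|].
  rewrite !sdeuE !dotf_mixr -!sdeuE.
  by apply: lerD; apply: ler_wpM2l => //; [exact: dv|exact: dw].
have [v0 v1 _ vs] := nv; have [w0 w1 _ ws] := nw.
split=> [s|s|s c _|]; rewrite ?mix_fctE.
- by rewrite v0 w0 !mulr0 addr0.
- have /andP[? ?] := v1 s; have /andP[? ?] := w1 s; apply/andP; split; nra.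
- have /andP[? ?] := normalized_bounds K_ge1 s c nv.
  have /andP[? ?] := normalized_bounds K_ge1 s c nw; apply/andP; split.
    by apply: addr_ge0; apply: mulr_ge0.
  by apply: lerD; apply: ler_wpM2l.
- under eq_bigr do rewrite mix_fctE.
  by rewrite big_split -!mulr_sumr vs ws /=; ring.
Qed.

Lemma rep_set_compact : compact (rep_set : set {ptws S * 'I_K.+1 -> R}).
Proof.
apply: subclosed_compact rep_set_closed (@box_compact R _ 1) _ => v [_ nv] [s c].
have /andP[v0 v1] := normalized_bounds K_ge1 s c nv.
by rewrite /= ger0_norm //; apply: le_trans v1 _; case: nv => _ /(_ s) /andP[].
Qed.


(** * Marginal and conditional utilities *)

(** The state-free utility through which [v] evaluates constant lotteries. *)
Definition marg v : 'I_K.+1 -> R := fun c => \sum_s v (s, c).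

Lemma marg_mix v w (a b : R) : marg (a *: v + b *: w) = a *: marg v + b *: marg w.
Proof.
apply/funext => c; rewrite mix_fctE /marg !mulr_sumr -big_split.
by apply: eq_bigr.
Qed.

Lemma marg_continuous :
  continuous (marg : {ptws S * 'I_K.+1 -> R} -> {ptws 'I_K.+1 -> R}).
Proof.
apply: (@ptws_continuous R {ptws S * 'I_K.+1 -> R} 'I_K.+1 marg) => c.
apply: (@sum_continuous R {ptws S * 'I_K.+1 -> R} S (fun s w => w (s, c))) => s.
exact: ptws_eval_continuous.
Qed.

Let margs : set ('I_K.+1 -> R) := marg @` rep_set.

Let margs_compact : compact (margs : set {ptws 'I_K.+1 -> R}).
Proof.
apply: (@continuous_compact {ptws S * 'I_K.+1 -> R} {ptws 'I_K.+1 -> R} marg);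
  last exact: rep_set_compact.
apply: continuous_subspaceT; exact: marg_continuous.
Qed.

Let margs_convex : convex_set (margs : set (convex_lmodType ('I_K.+1 -> R))).
Proof.
apply/convex_setP => _ _ t [v Vv <-] [w Vw <-] t0 t1.
exists (t *: v + (1 - t) *: w); last exact: marg_mix.
by have /convex_setP := rep_set_convex; exact.
Qed.

Lemma sdeu_constant v X s : constant_lottery X ->
  sdeu v X = dotf (fun c => X (s, c)) (marg v).
Proof.
move=> [_ cX]; rewrite /sdeu /dotf exchange_big; apply: eq_bigr => c _.
by rewrite mulr_sumr; apply: eq_bigr => s' _; rewrite (cX s' s).
Qed.

(* g is realised, up to a positive factor, as a difference of constant
   lotteries, to which state-independence applies. *)
Lemma rep_set_state_ge0 (s : S) (g : 'I_K.+1 -> R) : \sum_c g c = 0 ->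
  (forall v, rep_set v -> 0 <= dotf g (marg v)) ->
  forall v, rep_set v -> 0 <= \sum_c g c * v (s, c).
Proof.
move=> g0 gV v [dv nv].
have cu := @constant_lottery_uniform R S K.
(* The summand 1 keeps [M] positive when [g = 0]; with [e] below, [e * g] is bounded by the entries
   of the uniform lottery. *)
pose M := 1 + \sum_c `|g c|.
have gM c : `|g c| <= M.
  rewrite /M (bigD1 c) //= addrCA lerDl addr_ge0 //.
  by apply: sumr_ge0.
have M0 : 0 < M by rewrite /M ltr_wpDr // sumr_ge0.
pose e := (M * K.+1%:R)^-1.
have e0 : 0 < e by rewrite invr_gt0 mulr_gt0 // ltr0n.
pose W : acts S K R := fun x => e * g x.2.
pose X : acts S K R := uniform_lottery + W.
have XE x : X x = uniform_lottery x + e * g x.2 by [].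
have cX : constant_lottery X.
  split; last by move=> s1 s2 c; rewrite !XE.
  apply: lottery_uniformD => [[s' c]|s'].
    rewrite /W /= normrM gtr0_norm // /e invfM mulrAC ler_piMl ?invr_ge0 ?ler0n //.
    by rewrite mulrC ler_pdivrMr // mul1r.
  by rewrite /W /= -mulr_sumr g0 mulr0.
have XuE w s' : \sum_c X (s', c) * w (s', c) -
    \sum_c uniform_lottery (s', c) * w (s', c) = e * \sum_c g c * w (s', c).
  by rewrite -sumrB mulr_sumr; apply: eq_bigr => c _; rewrite XE /=; ring.
have Xu : pref X uniform_lottery.
  apply/(rep_set_represents cX.1 cu.1) => w Vw.
  rewrite /sdeu -sumrB; under eq_bigr do rewrite XuE.
  rewrite -mulr_sumr mulr_ge0 ?(ltW e0) //; have := gV w Vw.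
  by rewrite exchange_big; under [in X in _ -> X]eq_bigr do rewrite -mulr_sumr.
have := dual_cone_state s dv cX cu Xu.
by rewrite -subr_ge0 XuE pmulr_rge0.
Qed.

(** Project [q] onto [margs], at [marg w]. The supporting inequality at [marg w] holds on [margs],
    hence at [q] by [rep_set_state_ge0], which forces the distance to be 0. *)
Lemma rep_set_conditional v s : rep_set v -> 0 < v (s, csq1 K) ->
  margs (fun c => v (s, c) / v (s, csq1 K)).
Proof.
move=> Vv p0; set p := v (s, csq1 K) in p0 *; set q := fun c => _.
have marg0 w : rep_set w -> marg w (csq0 K) = 0.
  by move=> [_ [w0 _ _ _]]; apply: big1 => s' _; exact: w0.
have marg1 w : rep_set w -> marg w (csq1 K) = 1 by move=> [_ []].
have q0 : q (csq0 K) = 0 by have [_ [v0 _ _ _]] := Vv; rewrite /q v0 mul0r.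
have q1 : q (csq1 K) = 1 by rewrite /q mulfV // gt_eqF.
have V0 : margs !=set0.
  by have [w Vw] := rep_set_neq0; exists (marg w); exists w.
have [_ [w Vw <-] wP] := convex_projection q V0 margs_compact margs_convex.
pose f c := marg w c - q c.
pose M := dotf f (marg w).
(* Normalized utilities are 1 at consequence 1 and 0 at consequence 0. The first correction thus
   subtracts the constant [M]; the second makes the coefficients sum to 0 without changing the
   value. *)
pose h c := f c - M * (c == csq1 K)%:R.
pose g c := h c - (\sum_c' h c') * (c == csq0 K)%:R.
have delta (b : 'I_K.+1 -> R) c0 m : \sum_c m * (c == c0)%:R * b c = m * b c0.
  rewrite (bigD1 c0) //= eqxx mulr1 big1 ?addr0 // => c /negPf ->.
  by rewrite mulr0 mul0r.
have gE b : b (csq0 K) = 0 -> b (csq1 K) = 1 -> dotf g b = dotf f b - M.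
  move=> b0 b1; transitivity (dotf f b - M * b (csq1 K) - (\sum_c' h c') * b (csq0 K)).
    by rewrite -!delta /dotf -!sumrB; apply: eq_bigr => c _; rewrite /g /h; ring.
  by rewrite b0 b1 mulr0 subr0 mulr1.
have g0 : \sum_c g c = 0.
  transitivity (\sum_c h c - \sum_c (\sum_c' h c') * (c == csq0 K)%:R * 1).
    by rewrite -sumrB; apply: eq_bigr => c _; rewrite mulr1.
  by rewrite (delta (fun=> 1)) mulr1 subrr.
have gV w' : rep_set w' -> 0 <= dotf g (marg w').
  move=> Vw'; rewrite gE ?marg0 ?marg1 // /M /dotf -sumrB.
  have := wP (marg w') (ex_intro2 _ _ w' Vw' erefl).
  by congr (0 <= _); apply: eq_bigr => c _; rewrite /f; ring.
have gq : 0 <= dotf g q.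
  have := rep_set_state_ge0 s g0 gV Vv.
  have -> : dotf g q = (\sum_c g c * v (s, c)) / p.
    by rewrite mulr_suml; apply: eq_bigr => c _; rewrite mulrA.
  by move=> h0; rewrite divr_ge0 // ltW.
have dist0 : \sum_c (f c) ^+ 2 = 0.
  apply/le_anti; rewrite [X in _ && X]sumr_ge0 ?andbT; last by move=> *; exact: sqr_ge0.
  rewrite gE // subr_ge0 in gq.
  rewrite -subr_le0 in gq; apply: le_trans gq.
  rewrite /M /dotf -sumrB le_eqVlt; apply/orP; left; apply/eqP.
  by apply: eq_bigr => c _; rewrite /f; ring.
exists w => //; apply/funext => c; apply/eqP; rewrite -subr_eq0 -sqrf_eq0.
have /psumr_eq0P/(_ c isT)/eqP := dist0.
by apply=> *; exact: sqr_ge0.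
Qed.

(* Conditioning exhibits [marg v] as a convex combination of points of [margs]
   with weights [v (s, 1)]; when it is extreme, all of them coincide. *)
Lemma rep_set_pair_max (f : 'I_K.+1 -> R) :
  exists2 v, (rep_set `&` prob_util_pair) v &
    forall w, rep_set w -> dotf f (marg w) <= dotf f (marg v).
Proof.
have V0 : margs !=set0.
  by have [w Vw] := rep_set_neq0; exists (marg w); exists w.
have [_ [[v Vv <-] fmax vext]] := compact_extreme_max f V0 margs_compact.
have [_ nv] := Vv; have [_ v1 _ vs] := nv.
have null s c : ~ 0 < v (s, csq1 K) -> v (s, c) = 0.
  move=> /negP; rewrite -leNgt => h; have /andP[c0 c1] := normalized_bounds K_ge1 s c nv.
  by apply/le_anti; rewrite c0 (le_trans c1 h).
exists v; last by move=> w Vw; apply: fmax; exists w.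
(* The utility is the marginal itself, which extremality equates with the conditional utility in
   each non-null state. *)
split=> //; exists (fun s => v (s, csq1 K)), (marg v); split=> // s c.
have [p0|/negP p0] := boolP (0 < v (s, csq1 K)); last first.
  by rewrite (null s c p0) (null s (csq1 K) p0) mul0r.
have := vext S (fun s => v (s, csq1 K)) (fun s c => v (s, c) / v (s, csq1 K)) _ vs _ _ s p0.
move=> <-; first by rewrite mulrC divfK // gt_eqF.
- by move=> s'; have /andP[] := v1 s'.
- by move=> s' p'; exact: rep_set_conditional.
- move=> c'; apply: eq_bigr => s' _.
  have [p'|/negP p'] := boolP (0 < v (s', csq1 K)); last first.
    by rewrite (null s' c' p') (null s' (csq1 K) p') mul0r.
  by rewrite mulrC divfK // gt_eqF.
Qed.

Lemma rep_set_constant_max (s0 : S) X : constant_lottery X ->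
  exists2 v, (rep_set `&` prob_util_pair) v &
    forall w, rep_set w -> sdeu w X <= sdeu v X.
Proof.
move=> cX; have [v Vv vmax] := rep_set_pair_max (fun c => X (s0, c)).
by exists v => // w Vw; rewrite !(sdeu_constant _ s0 cX); exact: vmax.
Qed.

(** Maximizes the opposite functional, which is why [rep_set_pair_max] takes any [f] and not only
    rows of lotteries. *)
Lemma rep_set_constant_min (s0 : S) X : constant_lottery X ->
  exists2 v, (rep_set `&` prob_util_pair) v &
    forall w, rep_set w -> sdeu v X <= sdeu w X.
Proof.
move=> cX; have [v Vv vmax] := rep_set_pair_max (fun c => - X (s0, c)).
have dotN (x y : 'I_K.+1 -> R) : dotf (fun c => - x c) y = - dotf x y.
  by rewrite /dotf -sumrN; apply: eq_bigr => c _; rewrite mulNr.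
by exists v => // w Vw; rewrite !(sdeu_constant _ s0 cX) -lerN2 -!dotN; exact: vmax.
Qed.

End Representation.

(** * The preference induced by a probability/utility pair *)

Definition pref_of (R : realType) (S : finType) (K : nat) (v X Y : acts S K R) : Prop :=
  [/\ lottery X, lottery Y & sdeu v Y <= sdeu v X].

(** A1 to A5 come from linearity, continuity and normalization. The product form serves A6: between
    constant lotteries, the conditional difference on an event is its probability times a number
    independent of the state. *)
Lemma pref_of_axioms (R : realType) (S : finType) (K : nat) (v : acts S K R) :
  (1 <= K)%N -> prob_util_pair v -> normalized_sdeu v -> pref_axioms (pref_of v).
Proof.
move=> K_ge1 [p [u [p01 ps vE]]] nv; have [v0 v1 _ vs] := nv.
have sure0 : sdeu v (sure (csq0 K)) = 0 by rewrite sdeu_sure big1.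
have sure1 : sdeu v (sure (csq1 K)) = 1 by rewrite sdeu_sure vs.
have lsure c := @lottery_sure R S K c.
have sdeu_mix X Y (a b : R) : sdeu v (a *: X + b *: Y) = a * sdeu v X + b * sdeu v Y.
  by rewrite !sdeuE dotf_mixl.
split.
- split=> [X Y Z _ _ _ [lX _ XY] [_ lZ YZ]|X lX]; split=> //.
  exact: le_trans XY.
- move=> X Y Z a lX lY lZ a0 a1; split=> [] [_ _ XY]; split=> //.
  + by apply: lottery_mix => //; exact: ltW.
  + by apply: lottery_mix => //; exact: ltW.
  + by rewrite !sdeu_mix lerD2r ler_pM2l.
  + by move: XY; rewrite !sdeu_mix lerD2r ler_pM2l.
- move=> X Y X' Y' lX lY cX cY XY.
  have lim_lottery (Z : nat -> acts S K R) Z' :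
      (forall m, lottery (Z m)) -> {ptws, Z @ \oo --> Z'} -> lottery Z'.
    move=> lZ cZ.
    have clZ : closure (lottery : set {ptws S * 'I_K.+1 -> R}) Z'.
      by move=> B /cZ [N _ /(_ N (leqnn N)) BZ]; exists (Z N).
    split=> [s c|s].
      by apply: (closure_ge (@ptws_eval_continuous R _ (s, c)) _ clZ) => W lW; exact: lottery_ge0.
    apply: (closure_eq (g := fun W : {ptws _ -> _} => \sum_c W (s, c)) _ _ clZ).
      apply: (@sum_continuous R {ptws S * 'I_K.+1 -> R} 'I_K.+1 (fun c w => w (s, c))) => c.
      exact: ptws_eval_continuous.
    by move=> W lW; exact: lottery_sum1.
  split; [exact: lim_lottery cX|exact: lim_lottery cY|].
  have lim_sdeu (Z : nat -> acts S K R) Z' :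
      {ptws, Z @ \oo --> Z'} -> sdeu v (Z m) @[m --> \oo] --> sdeu v Z'.
    move=> cZ; have := cvg_comp _ _ cZ (@dotf_continuous R _ v Z').
    by rewrite /comp /= sdeuE dotfC; under eq_fun do rewrite dotfC -sdeuE.
  apply: (ler_cvg_to (lim_sdeu _ _ cY) (lim_sdeu _ _ cX)).
  by apply: nearW => m; have [] := XY m.
- move=> c c1; split; split=> //.
    by rewrite !sdeu_sure; apply: ler_sum => s _; have /andP[] := normalized_bounds K_ge1 s c nv.
  rewrite sure0 sdeu_sure sumr_ge0 // => s _.
  by have /andP[] := normalized_bounds K_ge1 s c nv.
- split; first by split=> //; rewrite sure0 sure1.
  by case=> _ _; rewrite sure0 sure1 ler10.
- move=> X Y E cX cY [e [e0 _ [_ _ Ee]]] EXY F Z lZ.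
  have u1 : u (csq1 K) = 1.
    by rewrite -vs; under eq_bigr do rewrite vE; rewrite -mulr_suml ps mul1r.
  (* The utility of [evlottery E] is at most the probability of [E], and at least [e], the utility
     of [sureprob e]. *)
  have PE : 0 < \sum_(s in E) p s.
    apply: lt_le_trans e0 _; move: Ee; rewrite sdeu_mix sure0 sure1 mulr0 addr0 mulr1.
    move/le_trans; apply; rewrite sdeu_splice [X in _ + X]big1 ?addr0 => [|s _].
      apply: ler_sum => s _; rewrite (bigD1 (csq1 K)) //= big1 ?addr0 => [|c /negPf c1].
        by rewrite /sure eqxx mul1r vE u1 mulr1.
      by rewrite /sure /= c1 mul0r.
    rewrite (bigD1 (csq0 K)) //= v0 mulr0 add0r big1 // => c /negPf c0.
    by rewrite /sure /= c0 mul0r.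
  pose D s := \sum_c (X (s, c) - Y (s, c)) * u c.
  have spliceB G : sdeu v (splice G X Z) - sdeu v (splice G Y Z) = \sum_(s in G) p s * D s.
    rewrite !sdeu_splice opprD addrACA subrr addr0 -sumrB; apply: eq_bigr => s _.
    by rewrite -sumrB mulr_sumr; apply: eq_bigr => c _; rewrite vE; ring.
  have D0 s : 0 <= D s.
    have [_ _] := EXY Z lZ; rewrite -subr_ge0 spliceB.
    rewrite (eq_bigr (fun s' => p s' * D s)) => [|s' _].
      by rewrite -mulr_suml pmulr_rge0.
    by congr (_ * _); apply: eq_bigr => c _; rewrite (cX.2 s' s) (cY.2 s' s).
  split; [exact: lottery_splice cX.1 lZ|exact: lottery_splice cY.1 lZ|].
  rewrite -subr_ge0 spliceB; apply: sumr_ge0 => s _.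
  by rewrite mulr_ge0 //; have /andP[] := p01 s.
Qed.

(** * Assembly of the representation theorem *)

Theorem theorem3 (R : realType) (S : finType) (K : nat)
    (S_neq0 : (0 < #|S|)%N) (K_ge1 : (1 <= K)%N)
    (pref : (S * 'I_K.+1 -> R) -> (S * 'I_K.+1 -> R) -> Prop)
    (pref_lot : on_lotteries pref) (pref_ax : pref_axioms pref) :
  exists V : set (S * 'I_K.+1 -> R),
    [/\ V !=set0,
        closed (V : set {ptws S * 'I_K.+1 -> R}),
        convex_set (V : set (convex_lmodType (S * 'I_K.+1 -> R))),
        V `<=` normalized_sdeu
      & represents V pref] /\
    (forall X, constant_lottery X ->
       (exists2 v, (V `&` prob_util_pair) v &
          forall w, V w -> sdeu w X <= sdeu v X) /\
       (exists2 v, (V `&` prob_util_pair) v &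
          forall w, V w -> sdeu v X <= sdeu w X)) /\
    (forall B : (S * 'I_K.+1 -> R) -> (S * 'I_K.+1 -> R) -> Prop,
       is_basis B pref ->
       (forall v, prob_util_pair v -> normalized_sdeu v ->
          (forall X Y, B X Y -> sdeu v Y <= sdeu v X) -> V v) /\
       (exists v, [/\ prob_util_pair v, normalized_sdeu v &
          forall X Y, B X Y -> sdeu v Y <= sdeu v X])).
Proof.
have /card_gt0P[s0 _] := S_neq0.
have V_max := rep_set_constant_max K_ge1 pref_lot pref_ax s0.
exists (rep_set pref); split; last split.
- split.
  + exact: rep_set_neq0.
  + exact: rep_set_closed.
  + exact: rep_set_convex.
  + by move=> v [].
  + exact: rep_set_represents.
- move=> X cX; split; first exact: V_max.
  exact: (rep_set_constant_min K_ge1 pref_lot pref_ax s0).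
- move=> B [B_pref prefB]; split=> [v pv nv Bv|].
    split=> // X Y XY.
    have [||X' Y' BXY|_ _] := prefB (pref_of v) _ _ _ X Y XY; last by [].
    + by move=> X' Y' [].
    + exact: pref_of_axioms.
    + by have [lX lY] := pref_lot _ _ (B_pref _ _ BXY); split=> //; exact: Bv.
  (* Any constant lottery would supply a pair in the set; the uniform one is at hand. *)
  have [v [[dv nv] pv] _] := V_max _ (@constant_lottery_uniform R S K).
  by exists v; split=> // X Y /B_pref; exact: dv.
Qed.
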